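(* Let $X,Y$ be real normed vector spaces, $K\subset Y$ a proper convex cone with $\operatorname{int}K\neq\emptyset$, $L\subset S_X$ a nonempty closed set, $A\subset X$ a nonempty closed set, and $F:X\rightrightarrows Y$ a set-valued map. If $(\overline{x},\overline{y})\in\operatorname{Gr}F\cap(A\times Y)$ is a local weak directional Pareto minimum point for $F$ on $A$ with respect to $L$, then $$D_DF(\overline{x},\overline{y})\bigl(T_B^L(A,\overline{x})\bigr)\cap(-\operatorname{int}K)=\emptyset .$$ Moreover, if $A=X$, then $$D_B^{L,S_Y}F(\overline{x},\overline{y})(X)\cap(-\operatorname{int}K)=\emptyset .$$
   Context: $S_X,S_Y$ denote the unit spheres. For a set $C$, $\operatorname{cone}C=\{tc\mid t\ge 0,\ c\in C\}$. A convex cone $K\subset Y$ is proper if $K\neq\{0\}$ and $K\neq Y$ (it need not be pointed). $\operatorname{Gr}F=\{(x,y)\mid y\in F(x)\}$, and the image of a set $S$ under a set-valued map $H$ is $H(S)=\bigcup_{x\in S}H(x)$. Local weak directional Pareto minimum: $(\overline{x},\overline{y})\in\operatorname{Gr}F\cap(A\times Y)$ is a local weak directional Pareto minimum point for $F$ on $A$ with respect to $L$ if there is a neighborhood $U$ of $\overline{x}$ such that $\bigl(F(U\cap A\cap(\overline{x}+\operatorname{cone}L))-\overline{y}\bigr)\cap(-\operatorname{int}K)=\emptyset$. Directional Bouligand tangent cone: $T_B^L(A,\overline{x})$ is the set of all $u\in X$ for which there are a sequence $(u_n)\subset\operatorname{cone}L$ with $u_n\to u$ and a sequence $(t_n)\subset(0,\infty)$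 with $t_n\to0$ such that $\overline{x}+t_nu_n\in A$ for all $n$. Dini lower derivative: $v\in D_DF(\overline{x},\overline{y})(u)$ iff for every sequence $(t_n)\subset(0,\infty)$ with $t_n\to0$ and every sequence $u_n\to u$ there is a sequence $v_n\to v$ such that $\overline{y}+t_nv_n\in F(\overline{x}+t_nu_n)$ for all $n\in\mathbb{N}$. Directional Bouligand derivative: for nonempty closed $L\subset S_X$, $M\subset S_Y$, $v\in D_B^{L,M}F(\overline{x},\overline{y})(u)$ iff there are $(u_n)\subset\operatorname{cone}L$ with $u_n\to u$, $(v_n)\subset\operatorname{cone}M$ with $v_n\to v$, and $(t_n)\subset(0,\infty)$ with $t_n\to0$ such that $\overline{y}+t_nv_n\in F(\overline{x}+t_nu_n)$ for all $n$. *)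

(* Defs.v *)
From HB Require Import structures.
From mathcomp Require Import all_boot all_order all_algebra.
From mathcomp Require Import all_classical all_reals all_analysis.

Set Implicit Arguments.
Unset Strict Implicit.
Unset Printing Implicit Defensive.

Import Order.TTheory GRing.Theory Num.Theory.
Import numFieldNormedType.Exports.

Local Open Scope classical_set_scope.
Local Open Scope ring_scope.

Definition unit_sphere (R : realType) (V : normedModType R) : set V :=
  [set v | `|v| = 1].
Arguments unit_sphere {R} V.

Definition cone (R : realType) (V : normedModType R) (C : set V) : set V :=
  [set v | exists t : R, exists2 c, C c & 0 <= t /\ v = t *: c].

(* Cones are stable under all scalars t >= 0, so a nonempty cone contains 0. *)
Definition convex_cone (R : realType) (V : normedModType R) (K : set V) : Prop :=
  (forall (t : R) k, 0 <= t -> K k -> K (t *: k)) /\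
  convex_set (K : set (convex_lmodType V)).

Definition proper_convex_cone (R : realType) (V : normedModType R)
    (K : set V) : Prop :=
  [/\ convex_cone K, K <> [set 0] & K <> setT].

(* A set-valued map from X to Y is a function X -> set Y. *)
Definition svgraph (X Y : Type) (F : X -> set Y) : set (X * Y) :=
  [set p | F p.1 p.2].

Definition svimage (X Y : Type) (F : X -> set Y) (S : set X) : set Y :=
  \bigcup_(x in S) F x.

Section directional.
Context {R : realType} {X Y : normedModType R}.
Implicit Types (F : X -> set Y) (A L : set X) (K M : set Y).

Definition local_weak_directional_Pareto_min K F A L (x : X) (y : Y) : Prop :=
  (svgraph F `&` (A `*` setT)) (x, y) /\
  exists2 U, nbhs x U &
    [set z - y | z in svimage F (U `&` A `&` [set x + v | v in cone L])]
    `&` [set - k | k in interior K] = set0.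

Definition dir_bouligand_tangent_cone L A (x : X) : set X :=
  [set u | exists (u_ : nat -> X) (t_ : nat -> R),
    [/\ forall n, cone L (u_ n),
        u_ n @[n --> \oo] --> u,
        forall n, 0 < t_ n,
        t_ n @[n --> \oo] --> (0 : R) &
        forall n, A (x + t_ n *: u_ n)]].

Definition dini_lower_derivative F (x : X) (y : Y) : X -> set Y := fun u =>
  [set v | forall (t_ : nat -> R) (u_ : nat -> X),
    (forall n, 0 < t_ n) ->
    t_ n @[n --> \oo] --> (0 : R) ->
    u_ n @[n --> \oo] --> u ->
    exists2 v_ : nat -> Y, v_ n @[n --> \oo] --> v &
      forall n, F (x + t_ n *: u_ n) (y + t_ n *: v_ n)].

Definition dir_bouligand_derivative L M F (x : X) (y : Y) : X -> set Y :=
  fun u => [set v | exists (u_ : nat -> X) (v_ : nat -> Y) (t_ : nat -> R),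
    [/\ (forall n, cone L (u_ n)) /\ u_ n @[n --> \oo] --> u,
        (forall n, cone M (v_ n)) /\ v_ n @[n --> \oo] --> v,
        (forall n, 0 < t_ n) /\ t_ n @[n --> \oo] --> (0 : R) &
        forall n, F (x + t_ n *: u_ n) (y + t_ n *: v_ n)]].

End directional.

(* Main.v *)
(* Along a tangent sequence x + t_n u_n with values y + t_n v_n in F, the limit
   v cannot lie in the open set - int K: otherwise v_n lies in it for large n,
   hence so does t_n v_n because K is a cone, while x + t_n u_n lies in the
   neighbourhood of x on which y is a weak minimum. *)

Require Import Defs.
From mathcomp Require Import all_boot all_order all_algebra.
From mathcomp Require Import all_classical all_reals all_analysis.
Import Order.TTheory GRing.Theory Num.Theory.
Import numFieldNormedType.Exports.
Local Open Scope classical_set_scope.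
Local Open Scope ring_scope.

(** Multiplication by [t^-1] is continuous and sends [t *: k] to [k], so it maps points near
    [t *: k] into [K]; scaling back by [t] keeps them in the cone. *)
Lemma interior_coneZ (R : realType) (V : normedModType R) (K : set V)
    (t : R) (k : V) :
  (forall (s : R) z, 0 <= s -> K z -> K (s *: z)) ->
  0 < t -> interior K k -> interior K (t *: k).
Proof.
move=> KZ t0 Kk.
have Kt : \forall z \near t *: k, K (t^-1 *: z).
  apply: (@scaler_continuous _ V t^-1 (t *: k)).
  by rewrite scalerA mulVf ?gt_eqF// scale1r.
apply: filterS Kt => z /(KZ t _ (ltW t0)).
by rewrite scalerA mulfV ?gt_eqF// scale1r.
Qed.

(** Common core of both claims, which differ only in where the sequences come from. *)
Lemma Pareto_min_tangent_limit {R : realType} {X Y : normedModType R}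
    {K : set Y} {L A : set X} {F : X -> set Y} {x : X} {y : Y}
    {u_ : nat -> X} {u : X} {v_ : nat -> Y} {v : Y} {t_ : nat -> R} :
  convex_cone K -> local_weak_directional_Pareto_min K F A L x y ->
  (forall n, cone L (u_ n)) -> u_ n @[n --> \oo] --> u ->
  v_ n @[n --> \oo] --> v ->
  (forall n, 0 < t_ n) -> t_ n @[n --> \oo] --> (0 : R) ->
  (forall n, A (x + t_ n *: u_ n)) ->
  (forall n, F (x + t_ n *: u_ n) (y + t_ n *: v_ n)) ->
  ~ interior K (- v).
Proof.
move=> [KZ _] [_ [U xU minU]] Lu uu vv t0 tt Atu Ftuv Kv.
have Kv_ : \forall n \near \oo, interior K (- v_ n).
  by have := cvgN vv; apply; apply: nbhs_interior.
have xtu : x + t_ n *: u_ n @[n --> \oo] --> x.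
  (* The limit [x] is rewritten as [x + 0 *: u] to match the limits of the terms. *)
  rewrite -[X in _ --> X]addr0 -(scale0r u).
  by apply: cvgD; [exact: cvg_cst|exact: cvgZ].
have Utu : \forall n \near \oo, U (x + t_ n *: u_ n) by exact: xtu.
have [n [Kvn Un]] := filter_ex (filterI Kv_ Utu).
(* For this [n], [t_ n *: v_ n] lies in the intersection that minimality makes empty. *)
suff: set0 (t_ n *: v_ n) by [].
rewrite -minU; split.
  exists (y + t_ n *: v_ n); last by rewrite addrC addKr.
  exists (x + t_ n *: u_ n) => //; split; first by split.
  exists (t_ n *: u_ n) => //.
  have [s [c Lc [s0 ->]]] := Lu n.
  exists (t_ n * s); exists c => //; split; last by rewrite scalerA.
  by rewrite mulr_ge0// ltW.
exists (t_ n *: - v_ n); last by rewrite scalerN opprK.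
exact: interior_coneZ.
Qed.

Theorem proposition3p4 (R : realType) (X Y : normedModType R)
    (K : set Y) (L A : set X) (F : X -> set Y) (x : X) (y : Y)
    (K_proper : proper_convex_cone K) (intK_neq0 : interior K !=set0)
    (L_sphere : L `<=` unit_sphere X) (L_neq0 : L !=set0) (L_closed : closed L)
    (A_neq0 : A !=set0) (A_closed : closed A)
    (xy_min : local_weak_directional_Pareto_min K F A L x y) :
  svimage (dini_lower_derivative F x y) (dir_bouligand_tangent_cone L A x)
    `&` [set - k | k in interior K] = set0 /\
  (A = setT ->
   svimage (dir_bouligand_derivative L (unit_sphere Y) F x y) setT
     `&` [set - k | k in interior K] = set0).
Proof.
have [Kcone _ _] := K_proper.
split.
  rewrite -subset0 => v [[u [u_ [t_ [Lu uu t0 tt Atu]]] Du] [k Kk kE]].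
  (* The Dini derivative allows every sequence, in particular the tangent one, whose points lie in
     [A]. *)
  have [v_ vv Ftuv] := Du t_ u_ t0 tt uu.
  apply: (Pareto_min_tangent_limit Kcone xy_min Lu uu vv t0 tt Atu Ftuv).
  by rewrite -kE opprK.
move=> AT; rewrite -subset0.
move=> v [[u _ [u_ [v_ [t_ [[Lu uu] [_ vv] [t0 tt] Ftuv]]]]] [k Kk kE]].
(* The derivative supplies all three sequences; membership in [A] is automatic on the whole
   space. *)
have Atu n : A (x + t_ n *: u_ n) by rewrite AT.
apply: (Pareto_min_tangent_limit Kcone xy_min Lu uu vv t0 tt Atu Ftuv).
by rewrite -kE opprK.
Qed.
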